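(* Let $\Omega$, $F$, $K$ be as in the context. Suppose that $\max_{x\in\Omega}|\operatorname{Min}(F(x),K)|<+\infty$. Then $(\mathcal{SP})$ satisfies (wFDVP).
   Context: $\mathbb{N}=\{1,2,\ldots\}$ and $[p]=\{1,\ldots,p\}$; $|A|$ denotes cardinality. Setting: $\Omega\subseteq\mathbb{R}^n$ is nonempty and closed; $F:\mathbb{R}^n\rightrightarrows\mathbb{R}^m$ is a set-valued mapping with $\Omega\subseteq \operatorname{dom}F:=\{x: F(x)\neq\emptyset\}$ and $F(x)$ compact for every $x\in\Omega$; $K\subseteq\mathbb{R}^m$ is a closed, convex, pointed ($K\cap(-K)=\{0\}$), solid ($\operatorname{int}K\ne\emptyset$) cone. For nonempty $A\subseteq\mathbb{R}^m$, $\operatorname{Min}(A,K):=\{y\in A: (y-K)\cap A=\{y\}\}$. Set optimization problem $(\mathcal{SP})$: minimize $F(x)$ over $x\in\Omega$ with respect to the lower set less relation. A point $\bar x\in\Omega$ is a weakly minimal solution of $(\mathcal{SP})$, written $\bar x\in\operatorname{wargmin}(\mathcal{SP})$, if there is no $x\in\Omega$ with $F(\bar x)\subseteq F(x)+\operatorname{int}K$. Multiobjective problem $(\mathcal{VP}_p)$, $p\in\mathbb{N}$: minimize $(y^1,\ldots,y^p)\in\mathbb{R}^{mp}$ with respect to the cone $K^p=\prod_{i=1}^pK$ over all feasible $(x,y^1,\ldots,y^p)$, i.e. $x\in\Omega$ and $y^i\in F(x)$ for all $i\in[p]$. A feasible $(\bar x,\bar y^1,\ldots,\bar y^p)$ is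 a weakly minimal solution if there is no feasible $(x,y^1,\ldots,y^p)$ with $\bar y^i-y^i\in\operatorname{int}K$ for all $i\in[p]$. The set $\operatorname{wargmin}_x(\mathcal{VP}_p)$ is the projection onto the $x$-component in $\mathbb{R}^n$ of the set of weakly minimal solutions of $(\mathcal{VP}_p)$. $(\mathcal{SP})$ satisfies the weakly minimal finite dimensional vectorization property (wFDVP) if there exists $p\in\mathbb{N}$ with $\operatorname{wargmin}_x(\mathcal{VP}_p)=\operatorname{wargmin}(\mathcal{SP})$. *)

(* Defs.v *)
From mathcomp Require Import all_boot all_order all_algebra.
From mathcomp Require Import all_classical all_reals all_analysis.
Set Implicit Arguments.
Unset Strict Implicit.
Unset Printing Implicit Defensive.
Import Order.TTheory GRing.Theory Num.Theory.
Import numFieldNormedType.Exports.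
Local Open Scope classical_set_scope.
Local Open Scope ring_scope.

Section Cones.
Context {R : realType} {m : nat}.
Implicit Types A B K : set 'rV[R]_m.

Definition set_add A B : set 'rV[R]_m := [set a + b | a in A & b in B].

Definition is_cone K := forall (t : R) y, 0 <= t -> K y -> K (t *: y).

Definition pointed_cone K := K `&` [set - y | y in K] = [set 0].

Definition solid K := K° !=set0.

Definition Min A K : set 'rV[R]_m :=
  [set y | A y /\ [set y - k | k in K] `&` A = [set y]].

End Cones.

Section Problems.
Context {R : realType} {n m : nat}.
Variables (Omega : set 'rV[R]_n) (F : 'rV[R]_n -> set 'rV[R]_m).
Variable K : set 'rV[R]_m.

Definition dom : set 'rV[R]_n := [set x | F x !=set0].

Definition wargmin_SP : set 'rV[R]_n :=
  [set xb | Omega xb /\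
     ~ exists x, Omega x /\ F xb `<=` set_add (F x) K°].

Definition VP_feasible (p : nat) : set ('rV[R]_n * ('I_p -> 'rV[R]_m)) :=
  [set z | Omega z.1 /\ forall i, F z.1 (z.2 i)].

Definition wargmin_VP (p : nat) : set ('rV[R]_n * ('I_p -> 'rV[R]_m)) :=
  [set zb | VP_feasible zb /\
     ~ exists z, VP_feasible z /\ forall i, K° (zb.2 i - z.2 i)].

Definition wargminx_VP (p : nat) : set 'rV[R]_n := fst @` @wargmin_VP p.

(* The number p of copies ranges over the positive integers. *)
Definition wFDVP := exists p : nat, (0 < p)%N /\ wargminx_VP p = wargmin_SP.

(* [max_(x in Omega) |Min (F x) K| < +oo]: the cardinalities are all finite and
   uniformly bounded; the maximum is then attained, being over integers. *)
Definition bounded_card_Min :=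
  exists N : nat, forall x, Omega x -> (Min (F x) K #<= `I_N)%card.

End Problems.

(* Main.v *)
(* A point violating weak minimality for (SP) violates it for every (VP_p),
   whatever p is.  Conversely, each value F x is compact, so it satisfies the
   domination property F x <= Min (F x) K + K (Zorn's lemma, lower bounds of
   chains coming from compactness).  If p is at least the number of minimal
   elements of F x, let y^1, ..., y^p enumerate all of them: a feasible point
   (x', y') improving every y^i by an element of int K gives
   F x <= Min (F x) K + K <= F x' + int K + K = F x' + int K. *)
Require Import Defs.
From mathcomp Require Import all_boot all_order all_algebra.
From mathcomp Require Import all_classical all_reals all_analysis.
Import Order.TTheory GRing.Theory Num.Theory.
Import numFieldNormedType.Exports.
Local Open Scope classical_set_scope.
Local Open Scope ring_scope.

Section ConeOrder.
Context {R : realType} {m : nat} {K : set 'rV[R]_m}.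
Hypotheses (K_cone : is_cone K) (K_convex : convex_set K).
Hypothesis K_pointed : pointed_cone K.

Lemma pointed_cone0 : K 0.
Proof. by have [] : (K `&` [set - y | y in K]) 0 by rewrite K_pointed. Qed.

Lemma pointed_cone_eq0 y : K y -> K (- y) -> y = 0.
Proof.
move=> Ky KNy; suff : [set 0 : 'rV[R]_m] y by [].
by rewrite -K_pointed; split=> //; exists (- y) => //; rewrite opprK.
Qed.

(** The sum is twice the midpoint: convexity gives the midpoint, and the cone property allows
    doubling. *)
Lemma convex_coneD x y : K x -> K y -> K (x + y).
Proof.
move=> Kx Ky.
have h0 : 0 <= 2^-1 :> R by rewrite invr_ge0.
have h1 : 2^-1 <= 1 :> R by rewrite invf_le1 ?ler1n.
have /set_mem/(K_cone _ _ (ler0n R 2)) :=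
  K_convex x y (Itv01 h0 h1) (mem_set Kx) (mem_set Ky).
have half : 1 - 2^-1 = 2^-1 :> R by rewrite {1}(splitr 1) mul1r addrK.
by rewrite /conv/= /unstable.onem half -scalerDr scalerA divff ?pnatr_eq0// scale1r.
Qed.

(** Translation by [y] carries a neighbourhood of [x] inside [K] to a neighbourhood of [x + y],
    which stays in [K] since [K] is closed under addition. *)
Lemma interior_coneD x y : K° x -> K y -> K° (x + y).
Proof.
move=> Kx Ky; rewrite /interior /=.
have : (z - y) @[z --> x + y] --> x + y - y.
  by apply: (@cvgB R 'rV[R]_m _ (nbhs (x + y))); [exact: cvg_id | apply: cvg_cst].
rewrite addrK => /(_ _ Kx); rewrite nbhs_simpl/=; apply: filterS => z Kz.
by rewrite -[z](subrK y); exact: convex_coneD.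
Qed.

Hypothesis K_closed : closed K.

Lemma closed_lower_section y : closed [set z | K (y - z)].
Proof.
suff /continuous_closedP/(_ K K_closed) : continuous (fun z : 'rV[R]_m => y - z) by [].
by move=> z; apply: (@cvgB R 'rV[R]_m _ (nbhs z)); [apply: cvg_cst | exact: cvg_id].
Qed.

Lemma Min_neq0 A : compact A -> A !=set0 -> Min A K !=set0.
Proof.
move=> Aco [a Aa].
(* The order is reversed, [t] lying below [s], so that a maximal element from [Zorn] is minimal for
   [K]. Antisymmetry is where pointedness enters. *)
pose ge (s t : {z : 'rV[R]_m | z \in A}) := `[< K (val s - val t) >].
have ge_refl s : ge s s by apply/asboolP; rewrite subrr; exact: pointed_cone0.
have ge_trans r s t : ge r s -> ge s t -> ge r t.
  move=> /asboolP rs /asboolP st; apply/asboolP.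
  have -> : val r - val t = (val r - val s) + (val s - val t) by rewrite addrA subrK.
  exact: convex_coneD.
have [s s_max] : exists t, forall s, ge t s -> s = t.
  apply: Zorn => //.
  - move=> s t /asboolP st /asboolP ts; apply/val_inj/subr0_eq.
    by apply: pointed_cone_eq0; rewrite ?opprB.
  move=> C Ctot; have [->|/set0P[c Cc]] := eqVneq C set0.
    by exists (exist _ a (mem_set Aa)).
  (* Totality gives every finite part of the chain a lower bound within the chain itself; this is
     the finite intersection property used below. *)
  have chain_lb (l : seq {z | z \in A}) : {in l, forall i, C i} ->
      exists2 t, C t & {in l, forall i, ge i t}.
    elim: l => [_|i l IH lC]; first by exists c.
    have [t Ct tl] : exists2 t, C t & {in l, forall i, ge i t}.
      by apply: IH => j jl; apply: lC; rewrite inE jl orbT.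
    have Ci : C i by apply: lC; rewrite mem_head.
    have [it|ti] := Ctot _ _ Ci Ct.
    + by exists t => // j; rewrite inE => /predU1P[->|/tl].
    + exists i => // j; rewrite inE => /predU1P[->|/tl jt]; last exact: ge_trans jt ti.
      exact: ge_refl.
  (* A common point of the closed sections of [A] below the members of [C] is a lower bound of
     [C]. *)
  move: Aco; rewrite compact_In0 => Aco.
  have [||z zC] := Aco _ C (fun i => A `&` [set z | K (val i - z)]).
  - by exists (fun i => [set z | K (val i - z)]) => // i _; exact: closed_lower_section.
  - move=> D DC; have [|t Ct tD] := chain_lb (finmap.enum_fset D).
      by move=> i /DC /set_mem.
    exists (val t) => i iD; split; first exact/set_mem/(valP t).
    exact/asboolP/tD.
  have [Az _] := zC _ Cc; exists (exist _ z (mem_set Az)) => t Ct.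
  by apply/asboolP; have [] := zC _ Ct.
exists (val s); split; first exact/set_mem/(valP s).
apply/seteqP; split=> [_ [[k Kk <-] Ak]|_ ->] /=.
- suff /(congr1 val) : exist (fun z => z \in A) _ (mem_set Ak) = s by [].
  by apply: s_max; apply/asboolP; rewrite /= opprB addrC subrK.
- split; last exact/set_mem/(valP s).
  by exists 0; [exact: pointed_cone0 | rewrite subr0].
Qed.

(** A minimal point of the compact section of [A] below [y] is minimal in all of [A]: whatever lies
    below it also lies below [y], hence in the section. *)
Lemma Min_domination A y : compact A -> A y -> exists2 z, Min A K z & K (y - z).
Proof.
move=> Aco Ay.
have [||z [[Az Kz] z_min]] := @Min_neq0 (A `&` [set z | K (y - z)]).
- exact: compact_closedI Aco (closed_lower_section y).
- by exists y; split=> //=; rewrite subrr; exact: pointed_cone0.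
exists z => //; split=> //; apply/seteqP; split=> [w [[k Kk <-] Ak]|_ ->] /=.
- suff : [set z] (z - k) by [].
  rewrite -z_min; split; first by exists k.
  by split=> //=; rewrite opprB addrCA addrC; exact: convex_coneD.
- by split=> //; exists 0; [exact: pointed_cone0 | rewrite subr0].
Qed.

End ConeOrder.

(** An injection into [I_N] is inverted on its range, and the remaining indices get the default [a],
    so repetitions are allowed. *)
Lemma card_le_I_enum (T : Type) (A : set T) (N : nat) (a : T) : A a ->
  (A #<= `I_N)%card ->
  exists f : 'I_N.+1 -> T, (forall i, A (f i)) /\ forall b, A b -> exists i, f i = b.
Proof.
move=> Aa /pcard_leP[g]; have g_inj : {in A &, injective g} by exact: inj.
have /choice[f fP] (i : 'I_N.+1) :
    exists b, A b /\ forall b', A b' -> g b' = i -> b = b'.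
  have [[b [Ab gb]]|no] := pselect (exists b, A b /\ g b = i).
    by exists b; split=> // b' Ab' gb'; apply: g_inj; [exact/mem_set | exact/mem_set | rewrite gb gb'].
  by exists a; split=> // b' Ab' gb'; case: no; exists b'.
exists f; split=> [i|b Ab]; first by have [] := fP i.
have gb : (g b < N.+1)%N by apply: ltnW; exact: (@funS _ _ _ _ g).
by exists (Ordinal gb); have [_] := fP (Ordinal gb); exact.
Qed.

Theorem theorem4p5 (R : realType) (n m : nat)
  (Omega : set 'rV[R]_n) (F : 'rV[R]_n -> set 'rV[R]_m) (K : set 'rV[R]_m)
  (Omega_neq0 : Omega !=set0) (Omega_closed : closed Omega)
  (Omega_dom : Omega `<=` dom F)
  (F_compact : forall x, Omega x -> compact (F x))
  (K_closed : closed K) (K_cone : is_cone K) (K_convex : convex_set K)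
  (K_pointed : pointed_cone K) (K_solid : solid K)
  (hmax : bounded_card_Min Omega F K) :
  wFDVP Omega F K.
Proof.
(* The successor makes the number of copies positive even when [N] is 0. *)
have [N minN] := hmax; exists N.+1; split=> //; apply/seteqP; split=> x.
- move=> [[x0 y] [[/= Ox Fy] y_min] <-]; split=> // -[x' [Ox' Fxx']].
  have /choice[y' y'P] i : exists z, F x' z /\ K° (y i - z).
    have [z Fz [k Kk zk]] := Fxx' _ (Fy i).
    by exists z; split=> //; rewrite -zk addrC addKr.
  apply: y_min; exists (x', y'); split; first by split=> // i; have [] := y'P i.
  by move=> i; have [] := y'P i.
- move=> [Ox x_min].
  have [a Ma] := Min_neq0 K_cone K_convex K_pointed K_closed _ (F_compact _ Ox) (Omega_dom _ Ox).
  have [y [yM yS]] := card_le_I_enum _ _ _ _ Ma (minN _ Ox).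
  exists (x, y) => //; split.
    by split=> //= i; have [] := yM i.
  move=> [[x' y'] [[/= Ox' Fy'] yy']]; apply: x_min; exists x'; split=> // b Fb.
  have [_ /yS[i <-] Kb] := Min_domination K_cone K_convex K_pointed K_closed _ _ (F_compact _ Ox) Fb.
  exists (y' i); first exact: Fy'.
  (* The first summand is in the interior of [K] by [yy'], the second in [K] by domination. *)
  exists (y i - y' i + (b - y i)); first exact: interior_coneD.
  by rewrite addrA subrKC subrKC.
Qed.
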